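(* Let $T$ be a tree (all of whose vertices have finite degree) with color classes $B$ and $W$ and path metric $d$. Let $h: \mathbf{Z} \to \mathbf{R}$ be a nondecreasing convex function, and let $z,w$ be vertices of $T$. Define $h_T(u,v) := h(d(u,v))$, $h_{T;z}(u) := h(d(u,z))$, and $h_{T;z,w}(u,v) := h(d(u,z)+d(v,w))$ for $u,v\in T$. (1) $h_{T;z}$ is convex on $T$. (2) Suppose that $h$ is even. Then $h_T$ is L-convex on $T^2$. Moreover, for $(u,v) \in T\times T$, the function $h_T$ on $\mathcal{F}(u)\times\mathcal{F}(v)$ is a sum of basic $\boldsymbol{k}$-submodular functions (up to an additive constant and with nonnegative coefficients). Namely, for $(s,t)\in\mathcal{F}(u)\times\mathcal{F}(v)$, $$h_T(s,t)-h(D)=\begin{cases}\Delta h(1)\,\delta(s,t) & \text{if } u=v\in W,\\ \Delta h(D)\,\theta_a(s) & \text{if } u\in W, v\in B,\\ \Delta h(D)\,\theta_b(t) & \text{if } u\in B, v\in W,\\ \Delta h(D)(\theta_a(s)+\theta_b(t))+\Delta^2h(D)\,\mu_{a,b}(s,t) & \text{if } u,v\in W, u\ne v,\\ 0 & \text{if } u,v\in B,\end{cases}$$ where $D:=d(u,v)$, and $a$ and $b$ are the vertices in $\mathcal{F}(u)$ and in $\mathcal{F}(v)$ nearest to $v$ and to $u$, respectively. (3) Suppose that $h$ is even and that $z,w$ belong to the same color class. Then $h_{T;z,w}$ is L-convex on $T^2$. Moreover, for $(u,v)\in T\times T$, the function $h_{T;z,w}$ on $\mathcal{F}(u)\times\mathcal{F}(v)$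 is a sum of basic $\boldsymbol{k}$-submodular functions (up to an additive constant and with nonnegative coefficients). Namely, for $(s,t)\in\mathcal{F}(u)\times\mathcal{F}(v)$, $$h_{T;z,w}(s,t)-h(D)=\begin{cases}\Delta h(D)\,\theta_a(s) & \text{if } u\in W, v\in B,\\ \Delta h(D)\,\theta_b(t) & \text{if } u\in B, v\in W,\\ \Delta h(D)(\theta_a(s)+\theta_b(t))+\Delta^2h(D)\,\mu_{a,b}(s,t) & \text{if } u,v\in W,\\ 0 & \text{if } u,v\in B,\end{cases}$$ where $D:=d(u,z)+d(v,w)$, and $a$ and $b$ are the vertices in $\mathcal{F}(u)$ and $\mathcal{F}(v)$ nearest to $z$ and $w$, respectively.
   Context: One-variable notions: for $h:\mathbf{Z}\to\mathbf{R}$, $\Delta h(t):=h(t)-h(t-1)$ and $\Delta^2h(t):=h(t+1)-2h(t)+h(t-1)$. $h$ is nondecreasing if $\Delta h(t)\ge0$ for all $t$, convex if $\Delta^2h(t)\ge 0$ for all $t$, and even if $(h(t-1)+h(t+1))/2=h(t)$ for every odd integer $t$. The vertex set of $T$ is also denoted $T$. For $u,v\in T$ and an integer $0\le t\le d(u,v)$, $[u,v]_t$ is the unique vertex on the $u$–$v$ path at distance $t$ from $u$. A function $f$ on $T$ is convex if for all $u,v\in T$ the function $t\mapsto f([u,v]_t)$ ($0\le t\le d(u,v)$; $+\infty$ elsewhere) is convex. Order: $u\prec v$ iff $u,v$ adjacent, $u\in W$, $v\in B$. For $u \in T$, $\mathcal{F}(u):=\{v \mid v\succeq u\}$, i.e.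 $\mathcal{F}(u)$ is $u$ together with all its neighbors if $u\in W$, and $\{u\}$ if $u\in B$. For $u,v\in T$ there is a unique pair $(a',b')$ with $d(u,v)=d(u,a')+d(a',b')+d(b',v)$, $d(u,a')=d(b',v)$, $d(a',b')\le1$; $u\bullet v,u\circ v$ are defined by $\{u\bullet v,u\circ v\}=\{a',b'\}$, $u\circ v\preceq u\bullet v$, and componentwise on $T^2$. $g:T^2\to\mathbf{R}\cup\{\infty\}$ is L-convex if $g(x)+g(y)\ge g(x\bullet y)+g(x\circ y)$ for all $x,y$. For a nonnegative integer $k$, $S_k$ is a $(k+1)$-element set with a specified element $0$, ordered by $0\prec u$ for $u\ne0$ with no other relations. $\mathcal{F}(u)$ is identified with $S_k$, $k=|\mathcal{F}(u)|-1$, with $u$ playing the role of $0$. For $a\in S_k$, $\theta_a:S_k\to\mathbf{R}$ is: $\theta_a(u)=-1$ if $u=a\ne0$; $0$ if $u=0$; $1$ otherwise. For $(a,a')\in S_k\times S_{k'}$, $\mu_{a,a'}:S_k\times S_{k'}\to\mathbf{R}$ is: $\mu_{a,a'}(u,v)=0$ if $u=a\ne0$ or $v=a'\ne0$ or $u=v=0$; $=1$ if ($v=0$, $u\neq 0$, $u\ne a$) or ($u=0$, $v\ne0$, $v\ne a'$); $=2$ otherwise. For a bijection $\sigma:S_k\to S_{k'}$ with $\sigma(0)=0$, $\delta_\sigma(u,v)=0$ if $v=\sigma(u)$, $1$ if exactly one of $u,v$ is $0$, and $2$ otherwise; $\delta:=\delta_{\mathrm{id}}$. On $S_k$, $u\wedge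 v$ is the meet, and $u\sqcup v:=u\vee v$ if $u,v$ are comparable and $0$ otherwise; extended componentwise to products $S_{\boldsymbol{k}}=S_{k_1}\times\cdots\times S_{k_n}$. $f:S_{\boldsymbol{k}}\to\mathbf{R}\cup\{\infty\}$ is $\boldsymbol{k}$-submodular if $f(x)+f(y)\ge f(x\wedge y)+f(x\sqcup y)$ for all $x,y$. A basic $\boldsymbol{k}$-submodular function is one of the form $f(x)=f'(x_i)$ with $f'$ a $k_i$-submodular function on $S_{k_i}$; or $f(x)=\delta_\sigma(x_i,x_j)$ with $i\ne j$ and $\sigma:S_{k_i}\to S_{k_j}$ a bijection with $\sigma(0)=0$; or $f(x)=\mu_{a,a'}(x_i,x_j)$ with $i\ne j$ and $(a,a')\in S_{k_i}\times S_{k_j}$. *)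

(* Defs.v *)
From HB Require Import structures.
From mathcomp Require Import all_boot all_order all_algebra finmap.
From mathcomp Require Import boolp classical_sets constructive_ereal reals.

Set Implicit Arguments.
Unset Strict Implicit.
Unset Printing Implicit Defensive.

Import Order.TTheory GRing.Theory Num.Theory.

Local Open Scope ring_scope.

(* Functions with values in R u {oo} are modelled as functions to \bar R that
   never take the value -oo. *)
Definition proper_ereal (R : realType) (X : Type) (f : X -> \bar R) : Prop :=
  forall x, f x != -oo%E.

Section OneVariable.
Variable R : realType.
Implicit Type h : int -> R.

Definition Delta h (t : int) : R := h t - h (t - 1).
Definition Delta2 h (t : int) : R := h (t + 1) - 2%:R * h t + h (t - 1).

Definition nondecreasing_int h : Prop := forall t, 0 <= Delta h t.
Definition convex_int h : Prop := forall t, 0 <= Delta2 h t.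
Definition even_int h : Prop :=
  forall t : int, odd `|t|%N -> (h (t - 1) + h (t + 1)) / 2%:R = h t.

(* Delta2 h t >= 0, with the subtraction cleared to avoid oo - oo. *)
Definition convex_int_ext (g : int -> \bar R) : Prop :=
  proper_ereal g /\ forall t, (g t + g t <= g (t + 1)%R + g (t - 1)%R)%E.

End OneVariable.

(* A tree with all degrees finite: the finite sets [nbr u] of neighbours encode
   a simple graph, which is connected and has no cycle.  Both [u; v] with u, v
   adjacent and the empty sequence are "cycles" for [ucycle], hence the
   condition on the size. *)
Record tree := Tree {
  vertex :> choiceType;
  nbr : vertex -> {fset vertex};
  nbr_irr : forall u, u \notin nbr u;
  nbr_sym : forall u v, (v \in nbr u) = (u \in nbr v);
  tree_connected : forall u v,
    exists2 p, path (fun x y => y \in nbr x) u p & last u p = v;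
  tree_acyclic : forall c : seq vertex,
    ucycle (fun x y => y \in nbr x) c -> (size c <= 2)%N }.

Section TreeMetric.
Variable T : tree.
Implicit Types u v x : T.

Definition adj : rel T := fun u v => v \in nbr u.

Definition walk_of_length u v : pred nat :=
  fun n => `[< exists p, [/\ path adj u p, last u p = v & size p = n] >].

Lemma walk_of_lengthP u v : exists n, walk_of_length u v n.
Proof.
have [p pp lp] := tree_connected u v.
by exists (size p); apply/asboolP; exists p.
Qed.

Definition dist u v : nat := ex_minn (walk_of_lengthP u v).

Definition simple_path u v : pred (seq T) :=
  fun p => [&& path adj u p, uniq (u :: p) & last u p == v].

Lemma simple_pathP u v : exists p, simple_path u v p.
Proof.
have [p pp <-] := tree_connected u v.
case/shortenP: pp => q pq uq _.
by exists q; rewrite /simple_path pq uq eqxx.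
Qed.

(* The vertices of the u-v path, starting with u. *)
Definition tree_path u v : seq T := u :: xchoose (simple_pathP u v).

(* [u, v]_t *)
Definition path_vertex u v (t : nat) : T :=
  head u [seq x <- tree_path u v | dist u x == t].

Definition convex_tree (R : realType) (f : T -> \bar R) : Prop :=
  forall u v, convex_int_ext (fun t : int =>
    if (0 <= t <= (dist u v)%:Z) then f (path_vertex u v `|t|%N) else +oo%E).

End TreeMetric.

Section ColouredTree.
Variables (T : tree) (B W : {pred T}).
Implicit Types u v : T.

Definition colour_classes : Prop :=
  (forall u, (u \in B) = (u \notin W)) /\
  (forall u v, adj u v -> (u \in W) = (v \in B)).

Definition prec u v : bool := [&& adj u v, u \in W & v \in B].
Definition preceq u v : bool := (u == v) || prec u v.

(* The pair (a', b') around the midpoint of the u-v path. *)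
Definition midpair u v : T * T :=
  xget (u, v) [set ab : T * T |
    [/\ dist u v = (dist u ab.1 + dist ab.1 ab.2 + dist ab.2 v)%N,
        dist u ab.1 = dist ab.2 v & (dist ab.1 ab.2 <= 1)%N]]%classic.

(* bullet is the larger and circ the smaller element of the mid pair. *)
Definition bullet u v : T :=
  let: (a, b) := midpair u v in if preceq a b then b else a.
Definition circ u v : T :=
  let: (a, b) := midpair u v in if preceq a b then a else b.

Definition bullet2 (x y : T * T) : T * T := (bullet x.1 y.1, bullet x.2 y.2).
Definition circ2 (x y : T * T) : T * T := (circ x.1 y.1, circ x.2 y.2).

Definition Lconvex (R : realType) (g : T * T -> \bar R) : Prop :=
  proper_ereal g /\
  forall x y, (g (bullet2 x y) + g (circ2 x y) <= g x + g y)%E.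

End ColouredTree.

(* S_k is given as an arbitrary finite set with a specified element 0; the
   number k is the cardinality minus one. *)
Record star := Star { star_sort :> finType; star0 : star_sort }.
Arguments star0 {_}.

Section Star.
Variable S : star.
Implicit Types u v w : S.

Definition star_le u v : bool := (u == star0) || (u == v).
Definition star_meet u v : S :=
  if star_le u v then u else if star_le v u then v else star0.
Definition star_sqcup u v : S :=
  if star_le u v then v else if star_le v u then u else star0.

Lemma star_meetP w u v : star_le w (star_meet u v) = star_le w u && star_le w v.
Proof.
rewrite /star_meet /star_le.
case: (eqVneq w star0) => [//|w0] /=.
case: (eqVneq u star0) => [->|u0] /=; first by rewrite (negPf w0).
case: (eqVneq u v) => [->|uv] /=; first by rewrite andbb.
case: (eqVneq v star0) => [->|v0] /=; first by rewrite (negPf w0) andbF.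
rewrite (negPf w0) /=.
by case: (eqVneq w u) => [->|//]; rewrite (negPf uv).
Qed.

Definition star_submodular (R : realType) (f : S -> \bar R) : Prop :=
  proper_ereal f /\
  forall x y, (f (star_meet x y) + f (star_sqcup x y) <= f x + f y)%E.

Definition theta (R : realType) (a u : S) : R :=
  if (u == a) && (a != star0) then -1 else if u == star0 then 0 else 1.

End Star.

Definition mu (R : realType) (S S' : star) (a : S) (a' : S') (u : S) (v : S')
    : R :=
  if [|| (u == a) && (a != star0), (v == a') && (a' != star0)
       | (u == star0) && (v == star0)] then 0
  else if [&& v == star0, u != star0 & u != a]
       || [&& u == star0, v != star0 & v != a'] then 1
  else 2%:R.

Definition delta (R : realType) (S S' : star) (sigma : S -> S') (u : S) (v : S')
    : R :=
  if v == sigma u then 0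
  else if (u == star0) (+) (v == star0) then 1 else 2%:R.

Section Basic.
Variables (R : realType) (n : nat) (S : 'I_n -> star).

Inductive basic_ksubmodular : ((forall i, S i) -> \bar R) -> Prop :=
| basic_unary i (f : S i -> \bar R) of star_submodular f :
    basic_ksubmodular (fun x => f (x i))
| basic_delta i j (sigma : S i -> S j)
    of i != j & bijective sigma & sigma star0 = star0 :
    basic_ksubmodular (fun x => (delta R sigma (x i) (x j))%:E)
| basic_mu i j (a : S i) (a' : S j) of i != j :
    basic_ksubmodular (fun x => (mu R a a' (x i) (x j))%:E).

Definition sum_of_basic (f : (forall i, S i) -> \bar R) : Prop :=
  exists (c : R) (m : nat) (coef : 'I_m -> R)
         (g : 'I_m -> (forall i, S i) -> \bar R),
    [/\ forall j, 0 <= coef j, forall j, basic_ksubmodular (g j)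
      & forall x, f x = (c%:E + \sum_(j < m) (coef j)%:E * g j x)%E].

End Basic.

Section Neighbourhood.
Variables (T : tree) (B W : {pred T}).
Implicit Types u v x : T.

(* { x | x >= u }; such x lie in the finite set u |` nbr u. *)
Definition filter_set u : {fset T} :=
  [fset x in (u |` nbr u)%fset | preceq B W u x]%fset.

Lemma mem_filter_set u x : (x \in filter_set u) = preceq B W u x.
Proof.
rewrite !inE /= /preceq /prec /adj.
by rewrite (eq_sym x u); case: (u == x); case: (x \in nbr u).
Qed.

Lemma filter_set_self u : u \in filter_set u.
Proof. by rewrite mem_filter_set /preceq eqxx. Qed.

(* F(u), as a copy of S_k with u in the role of 0. *)
Definition Fstar u : star := @Star (filter_set u) [` filter_set_self u]%fset.

Definition Fvertex u (s : Fstar u) : T := fsval s.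

(* F(u) x F(v) = S_k1 x S_k2, as a family indexed by 'I_2. *)
Definition Fstar2 u v (i : 'I_2) : star := Fstar (if i == ord0 then u else v).

Definition restrict2 (R : realType) (f : T * T -> \bar R) u v
    (x : forall i, Fstar2 u v i) : \bar R :=
  f (Fvertex (x ord0), Fvertex (x ord_max)).

Definition nearest u (a : Fstar u) (v : T) : Prop :=
  forall s : Fstar u, (dist (Fvertex a) v <= dist (Fvertex s) v)%N.

End Neighbourhood.
Arguments restrict2 {T} B W {R} f u v x.

Section DistanceFunctions.
Variables (R : realType) (T : tree) (h : int -> R).

Definition h_T (x : T * T) : R := h (dist x.1 x.2)%:Z.
Definition h_Tz (z : T) (u : T) : R := h (dist u z)%:Z.
Definition h_Tzw (z w : T) (x : T * T) : R :=
  h (dist x.1 z + dist x.2 w)%N%:Z.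

End DistanceFunctions.

(* Main.v *)
(* In a tree every vertex u has at most one neighbour closer to a given vertex,
   and this gives the four-point condition for the path metric.  Comparing the
   midpoints of u, u' and of v, v' with those of the diagonal u, v' then yields
     d(u o u', v o v') + d(u * u', v * v') <= d(u, v) + d(u', v').
   The two distances on the left differ by at most 2, and if they differ by 2
   then they are even, so that the even function h is affine between them: the
   L-convexity of h_T and h_{T;z,w} thus reduces to a majorization inequality
   for nondecreasing convex functions on the integers.  Locally, the distance
   from s in F(u) to v is d(u, v) + theta_a(s), and the explicit formulas are
   expansions of h around D up to distance 2. *)
Require Import Defs.
From mathcomp Require Import all_boot all_order all_algebra finmap.
From mathcomp Require Import boolp classical_sets constructive_ereal reals.
From mathcomp Require Import zify ring lra.

Set Implicit Arguments.
Unset Strict Implicit.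
Unset Printing Implicit Defensive.

Import Order.TTheory GRing.Theory Num.Theory.

Local Open Scope ring_scope.

(** * The path metric of a tree *)

Section TreeMetricTheory.
Variable T : tree.
Implicit Types u v x y z : T.
Local Open Scope nat_scope.
Local Arguments adj {T}.

Lemma adj_sym u v : adj u v = adj v u.
Proof. exact: nbr_sym. Qed.

Lemma adj_irrefl u : adj u u = false.
Proof. exact: negPf (nbr_irr u). Qed.

(** After the common initial steps, the first vertex [c] of one path that lies on the other closes a
    cycle with the two segments leading to it. *)
Lemma simple_path_unique u v p q :
  simple_path u v p -> simple_path u v q -> p = q.
Proof.
elim: p u q => [|x p IHp] u q.
  case/and3P=> _ _ /eqP /= <-; case: q => [//|y q] /and3P[_].
  rewrite cons_uniq => /andP[/negP uNq _] /eqP /= lq.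
  by case: uNq; have := mem_last y q; rewrite lq.
case: q => [|y q].
  move=> /and3P[_ + /eqP /= lp] /and3P[_ _ /eqP /= uv].
  by have := mem_last x p; rewrite cons_uniq lp -uv => ->.
have [<- /and3P[/andP[_ pp] /andP[_ up] lp]
      /and3P[/andP[_ pq] /andP[_ uq] lq]|xy] := eqVneq x y.
  by congr cons; apply: (IHp x); apply/and3P.
move=> /and3P[pp up /eqP lp] /and3P[pq uq /eqP lq]; exfalso.
have hPQ : has (mem (y :: q)) (x :: p).
  by apply/hasP; exists v;
     [rewrite -lp /=; apply: mem_last | rewrite -lq /=; apply: mem_last].
have [hP hQ] : head u (x :: p) = x /\ head u (y :: q) = y by [].
move: (x :: p) (y :: q) pp up {lp} pq uq {lq} hPQ hP hQ
  => P Q pp up pq uq hPQ hP hQ.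
case/split_find: hPQ pp up hP => c p1 p2 cQ p1Q pp up hP.
case/path.splitP: cQ pq uq hQ p1Q => q1 q2 pq uq hQ p1Q.
have pc : path adj u (rcons p1 c) by move: pp; rewrite cat_path => /andP[].
have qc : path adj c (rcons (rev q1) u).
  move: pq; rewrite cat_path => /andP[+ _].
  rewrite -(@eq_path _ (fun a b => adj b a)); last by move=> a b; rewrite adj_sym.
  by rewrite -rev_path last_rcons belast_rcons rev_cons.
have cyc : cycle adj (u :: p1 ++ c :: rev q1).
  by rewrite /= rcons_cat /= -cat_rcons cat_path pc last_rcons.
have unq : uniq (u :: p1 ++ c :: rev q1).
  have pu : uniq (u :: rcons p1 c).
    by move: up; rewrite -cat_cons cat_uniq => /andP[].
  have qu : uniq (u :: rcons q1 c).
    by move: uq; rewrite -cat_cons cat_uniq => /andP[].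
  move: pu qu; rewrite !cons_uniq !rcons_uniq !mem_rcons !inE !negb_or.
  move=> /and3P[/andP[uc up1] cp1 up1'] /and3P[/andP[_ uq1] cq1 uq1'].
  rewrite mem_cat inE !negb_or up1 uc mem_rev uq1 cat_uniq up1' /=.
  rewrite negb_or cp1 mem_rev cq1 rev_uniq uq1' !andbT /=.
  apply: contra p1Q => /hasP[a]; rewrite mem_rev => aq ap.
  by apply/hasP; exists a => //; rewrite /= mem_cat mem_rcons inE aq orbT.
have := @tree_acyclic T (u :: p1 ++ c :: rev q1) _.
rewrite /ucycle unq andbT => /(_ cyc).
rewrite /= size_cat /= size_rev.
(* A cycle of size at most 2 leaves [p1] and [q1] empty, so both paths would start with [c], against
   [x != y]. *)
case: p1 q1 hP hQ {pc qc cyc unq pp up pq uq p1Q} => [|a p1] [|b q1] /= hP hQ;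
  try by lia.
by case/eqP: xy; rewrite -hP -hQ.
Qed.

Lemma dist_le_size u p : path adj u p -> dist u (last u p) <= size p.
Proof.
move=> pp; rewrite /dist; case: ex_minnP => n _; apply.
by apply/asboolP; exists p.
Qed.

Lemma geodesic u v : exists2 p, simple_path u v p & size p = dist u v.
Proof.
rewrite /dist; case: ex_minnP => n /asboolP[p [pp lp szp]] le_n.
move: lp; case/shortenP: pp => q pq uq sqp lq.
exists q; first by apply/and3P; split=> //; apply/eqP.
apply/eqP; rewrite eqn_leq -{1}szp le_n ?andbT; last by apply/asboolP; exists q.
by apply: uniq_leq_size sqp; case/andP: uq.
Qed.

Lemma simple_path_size u v p : simple_path u v p -> size p = dist u v.
Proof.
by have [q sq <-] := geodesic u v => sp; rewrite (simple_path_unique sp sq).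
Qed.

Lemma distxx u : dist u u = 0.
Proof. by have := @dist_le_size u [::] isT; rewrite leqn0 => /eqP. Qed.

Lemma dist_eq0 u v : (dist u v == 0) = (u == v).
Proof.
apply/idP/eqP => [/eqP d0|->]; last by rewrite distxx.
have [p /and3P[_ _ /eqP lp]] := geodesic u v.
by rewrite d0 => /size0nil p0; rewrite -lp p0.
Qed.

Lemma dist_sym u v : dist u v = dist v u.
Proof.
wlog suff le_uv : u v / dist v u <= dist u v.
  by apply/eqP; rewrite eqn_leq !le_uv.
have [p /and3P[pp _ /eqP lp] <-] := geodesic u v.
have rp : path adj v (rev (belast u p)).
  by rewrite -lp rev_path (@eq_path _ _ adj) // => a b; rewrite adj_sym.
have lr : last v (rev (belast u p)) = u.
  by case: (p) lp => [|x q] //=; rewrite rev_cons last_rcons.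
by have := dist_le_size rp; rewrite lr size_rev size_belast.
Qed.

Lemma dist_triangle u v w : dist u w <= dist u v + dist v w.
Proof.
have [p /and3P[pp _ /eqP lp] <-] := geodesic u v.
have [q /and3P[pq _ /eqP lq] <-] := geodesic v w.
by rewrite -size_cat -lq -lp -last_cat dist_le_size // cat_path pp lp.
Qed.

Lemma dist_eq1 u v : (dist u v == 1) = adj u v.
Proof.
apply/idP/idP => [/eqP d1|uv].
  have [[|a [|b p]] /and3P[pp _ /eqP lp]] := geodesic u v; rewrite d1 // => _.
  by move: pp; rewrite -lp /= andbT.
rewrite eqn_leq lt0n dist_eq0 (@dist_le_size u [:: v]) /= ?uv //.
by apply: contraTneq uv => ->; rewrite adj_irrefl.
Qed.

Lemma adj_dist u a : adj u a -> dist u a = 1.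
Proof. by rewrite -dist_eq1 => /eqP. Qed.

(** If [p] met [u] again, the rest of [p] would be a walk from [u] to [z] shorter than
    [dist a z]. *)
Lemma simple_path_cons u a z p : adj u a -> dist a z <= dist u z ->
  simple_path a z p -> simple_path u z (a :: p).
Proof.
move=> ua le_az sp; have szp := simple_path_size sp.
case/and3P: (sp) => pp up lp; rewrite /simple_path /= ua pp lp.
move: up => /= ->; rewrite inE !andbT negb_or.
apply/andP; split; first by apply: contraTneq ua => ->; rewrite adj_irrefl.
apply/negP => up; case/splitPr: up sp szp pp lp => p1 p2 sp.
rewrite size_cat /= cat_path last_cat /= => szp /andP[_ /andP[_ p2u]] /eqP lp.
by have := dist_le_size p2u; rewrite lp; lia.
Qed.

Lemma dist_closer u a z : adj u a -> dist a z <= dist u z ->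
  dist u z = (dist a z).+1.
Proof.
have [p sp <-] := geodesic a z => ua le_az.
rewrite -(simple_path_size (simple_path_cons ua _ sp)) //.
by rewrite -(simple_path_size sp).
Qed.

(** Prepending [u] to geodesics from [a] and from [b] gives two simple paths from [u] to [z]; these
    coincide, and so do their first steps. *)
Lemma closer_unique u a b z : adj u a -> adj u b ->
  dist a z <= dist u z -> dist b z <= dist u z -> a = b.
Proof.
have [p sp _] := geodesic a z; have [q sq _] := geodesic b z.
move=> ua ub la lb.
by case: (simple_path_unique (simple_path_cons ua la sp)
                             (simple_path_cons ub lb sq)).
Qed.

Lemma closer_exists u z : u != z ->
  exists2 a, adj u a & dist u z = (dist a z).+1.
Proof.
move=> uz; have [[|a p] /and3P[/= + _ /eqP]] := geodesic u z.
  by move=> _ uz'; case/eqP: uz.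
case/andP=> ua pp lp szp; exists a => //; apply: dist_closer => //.
by have := dist_le_size pp; rewrite lp; lia.
Qed.

(* A walk that starts by moving away from z and then heads for y never turns
   back, so it is a geodesic. *)
Lemma dist_extend x x1 y z : adj x x1 -> dist x1 y < dist x y ->
  dist x z < dist x1 z -> dist z y = dist z x + dist x y.
Proof.
move: {2}(dist x y) (leqnn (dist x y)) => n.
elim: n x x1 => [|n IHn] x x1 le_n xx1 lt_y lt_z; first by lia.
have dy : dist x y = (dist x1 y).+1 by apply: dist_closer => //; lia.
have dz : dist x1 z = (dist x z).+1.
  by apply: dist_closer; [rewrite adj_sym | lia].
have [x1y|x1y] := eqVneq x1 y.
  by move: dy dz; rewrite x1y distxx (dist_sym y) (dist_sym x z) => -> ->; lia.
have [x2 x12 d2] := closer_exists x1y.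
(* The only neighbour of [x1] not farther from [z] is [x], and [x2] is closer to [y] than [x] is. *)
have lt2 : dist x1 z < dist x2 z.
  rewrite ltnNge; apply/negP => le2.
  have xx2 : x = x2.
    by apply: (closer_unique (z := z) _ x12); [rewrite adj_sym|lia|].
  by move: dy; rewrite xx2; lia.
rewrite (IHn x1 x2) //; [|lia..].
by move: dz; rewrite !(dist_sym z); lia.
Qed.

(* Induction on d(x, y), moving x towards y: a step that leads away from z shows
   that x lies between z and y, and then the triangle inequality suffices. *)
Lemma four_point x y z w :
  dist x y + dist z w <= maxn (dist x z + dist y w) (dist x w + dist y z).
Proof.
move: {2}(dist x y) (leqnn (dist x y)) => n.
elim: n x => [|n IHn] x le_n.
  have /eqP -> : x == y by rewrite -dist_eq0; lia.
  by have := dist_triangle z y w; rewrite distxx (dist_sym z y); lia.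
have [->|xy] := eqVneq x y.
  by have := dist_triangle z y w; rewrite distxx (dist_sym z y); lia.
have [x1 xx1 d1] := closer_exists xy.
have := IHn x1; have far t : dist x t < dist x1 t -> dist t y = dist t x + dist x y.
  by apply: dist_extend => //; lia.
have near t : dist x1 t <= dist x t -> dist x t = (dist x1 t).+1.
  exact: dist_closer.
have [/far yz|/near dz] := ltnP (dist x z) (dist x1 z).
  by have := dist_triangle z x w; rewrite (dist_sym y z); lia.
have [/far yw|/near dw] := ltnP (dist x w) (dist x1 w).
  by have := dist_triangle z x w;
     rewrite (dist_sym y w) (dist_sym z x) (dist_sym x w); lia.
by lia.
Qed.

Lemma geodesic_vertex u v k : k <= dist u v ->
  exists2 x, dist u x = k & dist x v = dist u v - k.
Proof.
elim: k => [|k IHk] le_k; first by exists u; rewrite ?distxx ?subn0.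
have [x ux xv] := IHk (ltnW le_k).
have xNv : x != v by rewrite -dist_eq0; lia.
have [a /adj_dist xa av] := closer_exists xNv.
exists a; last by lia.
by have := dist_triangle u x a; have := dist_triangle u a v; lia.
Qed.

Lemma path_vertex_dist u v t : t <= dist u v ->
  dist u (path_vertex u v t) = t /\ dist (path_vertex u v t) v = dist u v - t.
Proof.
move=> le_t; have sp := xchooseP (simple_pathP u v).
rewrite /path_vertex /tree_path; set p := xchoose _ in sp *.
have szp := simple_path_size sp; case/and3P: sp => pp _ /eqP lp.
have prefix_le p1 p2 : p = p1 ++ p2 ->
    dist u (last u p1) <= size p1 /\ dist (last u p1) v <= size p2.
  move=> pE; move: pp lp; rewrite pE cat_path last_cat => /andP[pp1 pp2] <-.
  by rewrite !dist_le_size.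
(* The two parts of the path bound the two distances, and their sizes add up to [dist u v]. *)
have on_path x : x \in u :: p -> dist u x + dist x v = dist u v.
  move=> xp; case/splitPl: xp prefix_le szp => p1 p2 lp1 prefix_le.
  have [] := prefix_le _ _ erefl.
  by have := dist_triangle u x v; rewrite lp1 size_cat; lia.
have [le1 le2] := prefix_le _ _ (esym (cat_take_drop t p)).
have xp : last u (take t p) \in u :: p.
  have := mem_last u (take t p).
  by rewrite !inE => /orP[->//|/mem_take ->]; rewrite orbT.
have := on_path _ xp; move: le1 le2; rewrite size_takel ?size_drop szp // => le1 le2 dE.
(* The filtered list is thus nonempty, and its head is a path vertex rather than the default of
   [head]. *)
have : last u (take t p) \in [seq x <- u :: p | dist u x == t].
  by rewrite mem_filter xp andbT; apply/eqP; lia.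
have : {subset [seq x <- u :: p | dist u x == t] <=
         [pred x | (x \in u :: p) && (dist u x == t)]}.
  by move=> x; rewrite mem_filter inE andbC.
case: [seq _ <- _ | _] => // x r /(_ x (mem_head _ _)) /andP[/on_path + /eqP].
by rewrite [head _ _]/=; lia.
Qed.

(** The defining property of [midpair] as a relation: estimates proved for every such pair do not
    depend on which one [xget] selects. *)
Definition is_midpair u v a b :=
  [/\ dist u v = dist u a + dist a b + dist b v,
      dist u a = dist b v & dist a b <= 1].

Lemma is_midpair_sym u v a b : is_midpair u v a b -> is_midpair v u b a.
Proof.
by move=> [d1 d2 d3]; split;
   rewrite ?(dist_sym v) ?(dist_sym b a) ?(dist_sym a u); lia.
Qed.

Lemma midpair_exists u v : exists a b, is_midpair u v a b.
Proof.
have [a ua av] := @geodesic_vertex u v (dist u v)./2 ltac:(lia).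
(* The distance from [a] to [b] is the parity of [dist u v]. *)
have [b ab bv] := @geodesic_vertex a v (dist u v - (dist u v)./2.*2) ltac:(lia).
by exists a, b; split; lia.
Qed.

Lemma midpair_ends u v a b : is_midpair u v a b ->
  dist u b = dist u a + dist a b /\ dist a v = dist a b + dist b v.
Proof.
case=> d1 d2 d3; have := dist_triangle u b v; have := dist_triangle u a b.
by have := dist_triangle u a v; have := dist_triangle a b v; lia.
Qed.

(** The four-point condition against [u], [v] bounds each of [dist a y] and [dist b y] by a maximum
    of two terms; the triangle inequality settles every combination. *)
Lemma midpair_convex u v a b y :
  is_midpair u v a b -> dist a y + dist b y <= dist u y + dist v y.
Proof.
move=> mab; have [ub av] := midpair_ends mab; case: mab => d1 d2 d3.
have := four_point a y u v; have := four_point b y u v.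
have := dist_triangle u y v; have := dist_triangle v u y.
have := dist_triangle u v y.
by rewrite (dist_sym v u) (dist_sym y u) (dist_sym y v) (dist_sym a u) (dist_sym b u); lia.
Qed.

(* The two midpoints lie on two sides of the tripod u, v, w, and the four-point
   condition gives d(a, c) <= max(|s - t|, s + t - 2 alpha), where s and t are
   their distances to u and alpha is the length of the leg at u. *)
Lemma midpair_common_end u v w a b c e :
  is_midpair u v a b -> is_midpair u w c e -> dist a c + dist b e <= dist v w.
Proof.
move=> mab mce.
have [ub av] := midpair_ends mab; case: mab => d1 d2 d3.
have [ue cw] := midpair_ends mce; case: mce => d4 d5 d6.
have := four_point a w u v; have := four_point a c u w.
have := four_point b w u v; have := four_point b e u w.
have := dist_triangle u v w; have := dist_triangle u w v.
have := dist_triangle v u w.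
by rewrite (dist_sym w u) (dist_sym w v) (dist_sym v u) (dist_sym a u)
  (dist_sym b u) (dist_sym c u) (dist_sym e u); lia.
Qed.

Lemma midpair_dist u u' v v' a b c e :
  is_midpair u u' a b -> is_midpair v v' c e ->
  dist a c + dist b e <= dist u v + dist u' v'.
Proof.
move=> mab mce; have [f [g mfg]] := midpair_exists u v'.
have := midpair_common_end mab mfg.
have := midpair_common_end (is_midpair_sym mfg) (is_midpair_sym mce).
have := dist_triangle a f c; have := dist_triangle b g e.
lia.
Qed.

End TreeMetricTheory.

(** * Colour classes and midpoints *)

Section ColouredTreeTheory.
Variables (T : tree) (B W : {pred T}).
Hypothesis hBW : colour_classes B W.
Implicit Types u v x y z : T.
Local Open Scope nat_scope.

Lemma adj_colour u v : adj u v -> (v \in W) = (u \notin W).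
Proof.
by case: hBW => BW flip uv; rewrite (flip u v uv) BW negbK.
Qed.

Lemma odd_dist u v : odd (dist u v) = (u \in W) (+) (v \in W).
Proof.
move: {2}(dist u v) (erefl (dist u v)) => n; elim: n u => [|n IHn] u dn.
  by have /eqP -> : u == v by [rewrite -dist_eq0 dn]; rewrite distxx addbb.
have uv : u != v by rewrite -dist_eq0 dn.
have [a ua da] := closer_exists uv.
by rewrite da /= IHn ?(adj_colour ua); [case: (u \in W); case: (v \in W) | lia].
Qed.

Lemma preceq_adj u v : adj u v -> preceq B W u v = (u \in W).
Proof.
move=> uv; rewrite /preceq /prec uv /=.
have -> /= : (u == v) = false by apply: contraTF uv => /eqP ->; rewrite adj_irrefl.
by case: hBW => BW _; rewrite BW (adj_colour uv) negbK andbb.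
Qed.

(** The order of the mid pair is left open; the colours identify [circ] and [bullet] when they
    differ. *)
Lemma bullet_circP u v : exists a b,
  [/\ is_midpair u v a b,
      (circ B W u v, bullet B W u v) \in [:: (a, b); (b, a)]
    & circ B W u v != bullet B W u v ->
      (circ B W u v \in W) && (bullet B W u v \notin W)].
Proof.
have mab : is_midpair u v (midpair u v).1 (midpair u v).2.
  have [a [b mab]] := midpair_exists u v.
  by apply: (@xgetPex _ (u, v) [set ab : T * T | is_midpair u v ab.1 ab.2]%classic);
     exists (a, b).
rewrite /circ /bullet; case: (midpair u v) mab => a b /= mab; exists a, b.
have [ab|ab] := eqVneq a b.
  by rewrite ab /preceq eqxx /= in mab *; split; rewrite ?inE ?eqxx.
have aab : adj a b.
  by rewrite -dist_eq1; case: mab => _ _; have := dist_eq0 a b; rewrite (negPf ab); lia.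
rewrite preceq_adj //; have := adj_colour aab.
by case: ifP => aW bW; split; rewrite ?inE ?eqxx ?orbT ?aW ?bW ?aW.
Qed.

Lemma bullet_circ_dist_le1 u v : dist (circ B W u v) (bullet B W u v) <= 1.
Proof.
have [a [b [[_ _ ab] + _]]] := bullet_circP u v.
by rewrite !inE => /orP[] /eqP[-> ->] //; rewrite dist_sym.
Qed.

Lemma bullet_circ_convex u v z :
  dist (bullet B W u v) z + dist (circ B W u v) z <= dist u z + dist v z.
Proof.
have [a [b [mab + _]]] := bullet_circP u v; have := midpair_convex z mab.
by rewrite !inE => ? /orP[] /eqP[-> ->]; lia.
Qed.

Lemma bullet_circ_dist u u' v v' :
  dist (bullet B W u u') (bullet B W v v') + dist (circ B W u u') (circ B W v v')
  <= dist u v + dist u' v'.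
Proof.
have [a [b [mab abE abW]]] := bullet_circP u u'.
have [c [e [mce ceE ceW]]] := bullet_circP v v'.
have := midpair_dist mab mce; have [_ _ ab] := mab; have [_ _ ce] := mce.
have pos x y : (x \in W) != (y \in W) -> 0 < dist x y.
  by rewrite lt0n dist_eq0; apply: contraNneq => ->.
(* This serves the case of mid pairs listed in opposite orders. In the four-point bound the term
   [dist a b + dist e c] is at most 2, while the colours make [dist a c] and [dist b e] at least 1
   each. *)
have cross : (a \in W) != (c \in W) -> (b \in W) != (e \in W) ->
    dist a e + dist b c <= dist a c + dist b e.
  move=> /pos ac /pos be; have := four_point a e b c.
  by rewrite (dist_sym e c) (dist_sym e b); lia.
move: abE ceE abW ceW; rewrite !inE => /orP[] /eqP[-> ->] /orP[] /eqP[-> ->]; try lia.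
- have [->|ab'] := eqVneq a b; first by lia.
  have [->|ec'] := eqVneq e c; first by lia.
  by move=> /(_ isT)/andP[aW bW] /(_ isT)/andP[eW cW];
     move: cross; rewrite aW eW (negPf bW) (negPf cW) => /(_ isT isT); lia.
- have [->|ba'] := eqVneq b a; first by lia.
  have [->|ce'] := eqVneq c e; first by lia.
  by move=> /(_ isT)/andP[bW aW] /(_ isT)/andP[cW eW];
     move: cross; rewrite bW cW (negPf aW) (negPf eW) => /(_ isT isT); lia.
Qed.

Lemma circ_in_W u v :
  dist (circ B W u v) (bullet B W u v) != 0 -> circ B W u v \in W.
Proof.
by have [a [b [_ _ colW]]] := bullet_circP u v; rewrite dist_eq0 => /colW/andP[].
Qed.

End ColouredTreeTheory.

(** * Even convex functions on the integers *)

Section DiscreteConvexity.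
Variables (R : realType) (h : int -> R).
Hypotheses (h_nondecr : nondecreasing_int h) (h_convex : convex_int h).

Lemma Delta_succ t : Delta h (t + 1) = Delta h t + Delta2 h t.
Proof. by rewrite /Delta /Delta2 addrK; ring. Qed.

(** The slope of [h] just to the right of [n] is a subgradient at [n], because slopes increase. *)
Lemma convex_subgradient n t : h n + (t - n)%:~R * Delta h (n + 1) <= h t.
Proof.
have mono m k : Delta h m <= Delta h (m + k%:Z).
  elim: k => [|k IHk]; first by rewrite addr0.
  by rewrite -addn1 PoszD addrA Delta_succ (le_trans IHk) // lerDl.
have up k : h n + k%:R * Delta h (n + 1) <= h (n + k%:Z).
  elim: k => [|k IHk]; first by rewrite mul0r !addr0.
  have := mono (n + 1) k; rewrite {2}/Delta -addrA (addrC 1) addrA addrK.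
  rewrite -[k.+1]addn1 natrD PoszD addrA; lra.
have down k : h n - k%:R * Delta h (n + 1) <= h (n - k%:Z).
  elim: k => [|k IHk]; first by rewrite mul0r !subr0.
  have := mono (n - k%:Z) k.+1; rewrite {1}/Delta.
  have -> : n - k%:Z + k.+1 = n + 1 by lia.
  rewrite -[k.+1]addn1 natrD PoszD opprD addrA; lra.
case: (lerP n t) => nt.
  have [k ->] : exists k : nat, t = n + k by exists `|t - n|%N; lia.
  by have -> : n + k%:Z - n = k; [lia | apply: up].
have [k ->] : exists k : nat, t = n - k%:Z by exists `|n - t|%N; lia.
by have -> : n - k%:Z - n = - k%:Z; [lia | rewrite mulrNz mulNr; apply: down].
Qed.

(** Equal or consecutive [n1], [n2] both lie on one supporting line of [h]. Adding its bounds at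
    [m1] and [m2] suffices, since its slope is nonnegative. *)
Lemma convex_majorize (n1 n2 m1 m2 : int) : n1 <= n2 + 1 -> n2 <= n1 + 1 ->
  n1 + n2 <= m1 + m2 -> h n1 + h n2 <= h m1 + h m2.
Proof.
wlog le12 : n1 n2 / n1 <= n2 => [wl|].
  have [/wl//|/ltW/wl{}wl ? ? ?] := lerP n1 n2.
  by rewrite addrC wl // addrC.
move=> _ le21 lem; have s1 := convex_subgradient n1 m1; have s2 := convex_subgradient n1 m2.
have h2 : h n2 = h n1 + (n2 - n1)%:~R * Delta h (n1 + 1).
  have [->|->] : n2 = n1 \/ n2 = n1 + 1 by lia.
    by rewrite subrr mul0r addr0.
  by rewrite addrAC subrr add0r mul1r /Delta addrK; ring.
have : (n2 - n1)%:~R * Delta h (n1 + 1)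
    <= ((m1 - n1) + (m2 - n1))%:~R * Delta h (n1 + 1).
  by rewrite ler_wpM2r // ler_int; lia.
rewrite intrD mulrDl; lra.
Qed.

Lemma even_Delta t : even_int h -> odd `|t|%N -> Delta h (t + 1) = Delta h t.
Proof. by move=> hE /hE; rewrite /Delta addrK; lra. Qed.

Lemma even_convex_majorize (n1 n2 m1 m2 : nat) : even_int h ->
  (n1 <= n2 + 2)%N -> (n2 <= n1 + 2)%N ->
  ((n1.+1 < n2)%N || (n2.+1 < n1)%N -> ~~ odd n1) ->
  (n1 + n2 <= m1 + m2)%N -> h n1 + h n2 <= h m1 + h m2.
Proof.
move=> hE le12 le21 par lem.
have [far|near] := boolP ((n1.+1 < n2)%N || (n2.+1 < n1)%N); last first.
  by apply: convex_majorize; lia.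
have [m [em evm]] : exists m, ((n1 = m /\ n2 = m.+2) \/ (n2 = m /\ n1 = m.+2))
    /\ ~~ odd m.
  by exists (minn n1 n2); move: (par far); lia.
(* Evenness at the odd point [m.+1] replaces a pair with gap 2 by two equal arguments. *)
have mid : h m + h m.+2 = h m.+1 + h m.+1.
  have := @hE m.+1 evm.
  have -> : m.+1%:Z - 1 = m by lia.
  have -> : m.+1%:Z + 1 = m.+2 by lia.
  lra.
case: em => -[-> ->] in lem *; last rewrite addrC.
  by rewrite mid; apply: convex_majorize; lia.
by rewrite mid; apply: convex_majorize; lia.
Qed.

End DiscreteConvexity.

(** * Basic functions on stars *)

Section StarFunctions.
Variable R : realType.

(** Comparable arguments give equality. Incomparable ones are distinct and nonzero with meet and
    join 0, and at most one of them has value -1. *)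
Lemma star_submodular_theta (S : star) (a : S) :
  star_submodular (fun u => (theta R a u)%:E).
Proof.
split=> // x y; rewrite -!EFinD lee_fin /star_meet /star_sqcup.
have [_|] := boolP (star_le x y); first by [].
have [_ _|] := boolP (star_le y x); first by rewrite addrC.
rewrite /star_le !negb_or => /andP[y0 yx] /andP[x0 _].
rewrite /theta eqxx (negPf x0) (negPf y0) [star0 == a]eq_sym andbN.
have [xa|_] := eqVneq x a; last by rewrite /=; case: ifP => _; lra.
by rewrite -xa (negPf yx) /= x0; lra.
Qed.

(** An integer version of [theta], to be added to distances inside the argument of [h]. *)
Definition theta_int (S : star) (a u : S) : int :=
  if (u == a) && (a != star0) then -1 else if u == star0 then 0 else 1.

Lemma thetaE (S : star) (a u : S) : theta R a u = (theta_int a u)%:~R.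
Proof. by rewrite /theta /theta_int; do 2?case: ifP. Qed.

Lemma theta_intP (S : star) (a u : S) :
  [\/ theta_int a u = -1, theta_int a u = 0 | theta_int a u = 1].
Proof.
by rewrite /theta_int; case: ifP; [constructor 1 | case: ifP; [constructor 2|constructor 3]].
Qed.

(** In this form the local expansion depends only on the two values of [theta_int], which leaves
    nine cases. *)
Lemma muE (S S' : star) (a u : S) (a' v : S') :
  mu R a a' u v =
  if (theta_int a u == -1) || (theta_int a' v == -1) then 0
  else (theta_int a u + theta_int a' v)%:~R.
Proof.
rewrite /mu /theta_int.
by have [->|ua] := eqVneq u a; have [->|va] := eqVneq v a';
   case: (a == star0); case: (a' == star0);
   case: (u == star0); case: (v == star0).
Qed.

(** Zero coefficients are allowed, so one statement covers all colour combinations of the two base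
    vertices. *)
Lemma sum_of_basic2 (S : 'I_2 -> star) (a : S ord0) (b : S ord_max)
    (c p q r : R) (f : (forall i, S i) -> \bar R) :
  0 <= p -> 0 <= q -> 0 <= r ->
  (forall x, f x = (c + (p * theta R a (x ord0) + q * theta R b (x ord_max)
                     + r * mu R a b (x ord0) (x ord_max)))%:E) ->
  sum_of_basic f.
Proof.
move=> p0 q0 r0 fE.
pose g (j : 'I_3) (x : forall i, S i) : \bar R := match val j with
  | 0%N => (theta R a (x ord0))%:E
  | 1%N => (theta R b (x ord_max))%:E
  | _ => (mu R a b (x ord0) (x ord_max))%:E end.
exists c, 3, (fun j => match val j with 0%N => p | 1%N => q | _ => r end), g.
split=> [[[|[|[|]]]]//|[[|[|[|//]]] i3]|x].
- exact: (@basic_unary _ _ _ ord0 _ (star_submodular_theta a)).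
- exact: (@basic_unary _ _ _ ord_max _ (star_submodular_theta b)).
- exact: (@basic_mu R _ S ord0 ord_max a b isT).
- by rewrite fE !big_ord_recl big_ord0 /g /= adde0 -!EFinM -!EFinD !addrA.
Qed.

Lemma sum_of_basic_delta (S : 'I_2 -> star) (sigma : S ord0 -> S ord_max)
    (c p : R) (f : (forall i, S i) -> \bar R) :
  bijective sigma -> sigma star0 = star0 -> 0 <= p ->
  (forall x, f x = (c + p * delta R sigma (x ord0) (x ord_max))%:E) ->
  sum_of_basic f.
Proof.
move=> bij s0 p0 fE.
exists c, 1, (fun=> p), (fun _ (x : forall i, S i) => (delta R sigma (x ord0) (x ord_max))%:E).
split=> // [_|x]; first exact: (@basic_delta R _ S ord0 ord_max sigma isT bij s0).
by rewrite fE big_ord1 -EFinM -EFinD.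
Qed.

End StarFunctions.

(** * Local expansions of even functions *)

Section EvenConvex.
Variables (R : realType) (h : int -> R).
Hypothesis hE : even_int h.

(** At an odd [D], evenness makes [h] affine on [D - 1, D + 1]. *)
Lemma even_theta (S : star) (a s : S) (D : int) : odd `|D|%N ->
  h (D + theta_int a s) - h D = Delta h D * theta R a s.
Proof.
move=> Dodd; rewrite thetaE; have := even_Delta hE Dodd; rewrite /Delta addrK.
by case: (theta_intP a s) => ->; rewrite ?addr0; lra.
Qed.

(** At an even [D], [h] is affine on [D - 2, D] and on [D, D + 2]; the [mu] term supplies the change
    of slope at [D]. *)
Lemma even_theta_mu (S S' : star) (a s : S) (b t : S') (D : int) :
  ~~ odd `|D|%N ->
  h (D + (theta_int a s + theta_int b t)) - h D
  = Delta h D * (theta R a s + theta R b t) + Delta2 h D * mu R a b s t.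
Proof.
move=> Deven; rewrite !thetaE muE.
have := @even_Delta _ _ (D + 1) hE ltac:(lia).
have := @even_Delta _ _ (D - 1) hE ltac:(lia).
rewrite /Delta2 /Delta subrK !addrK.
have -> : D - 1 - 1 = D - 2 by lia.
have -> : D + 1 + 1 = D + 2 by lia.
case: (theta_intP a s) => ->; case: (theta_intP b t) => -> /=;
  by rewrite ?addr0 ?subrr ?addr0 ?add0r; lra.
Qed.

End EvenConvex.

(** * Distances from and between the sets F(u) *)

Section Filters.
Variables (T : tree) (B W : {pred T}).
Hypothesis hBW : colour_classes B W.
Implicit Types u v x y z : T.

Lemma Fvertex_eq u (s t : Fstar B W u) : (Fvertex s == Fvertex t) = (s == t).
Proof. exact: (inj_eq val_inj). Qed.

Lemma Fvertex_star0 u (s : Fstar B W u) : (Fvertex s == u) = (s == star0).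
Proof. exact: (@Fvertex_eq u s star0). Qed.

Lemma Fvertex_adj u (s : Fstar B W u) : s != star0 -> adj u (Fvertex s).
Proof.
rewrite -Fvertex_star0 => su; have := fsvalP s.
by rewrite mem_filter_set /preceq eq_sym (negPf su) => /and3P[].
Qed.

Lemma Fvertex_dist u (s : Fstar B W u) : (dist u (Fvertex s) <= 1)%N.
Proof.
have [/eqP|/Fvertex_adj/adj_dist ->//] := eqVneq s star0.
by rewrite -Fvertex_star0 => /eqP ->; rewrite distxx.
Qed.

Lemma Fvertex_B u (s : Fstar B W u) : u \in B -> Fvertex s = u.
Proof.
case: hBW => BW _; rewrite BW => /negPf uW; have := fsvalP s.
by rewrite mem_filter_set /preceq /prec uW andbF orbF => /eqP.
Qed.

Lemma nearest_exists u v : exists a : Fstar B W u, nearest a v.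
Proof.
have := @arg_minnP (Fstar B W u) star0 predT (fun s => dist (Fvertex s) v) isT.
by case=> a _ a_min; exists a => s; apply: a_min.
Qed.

(** At most one neighbour of [u] is closer to [v], and then it is [a]; all others are one step
    farther. For [u = v] the nearest point is [star0], where [theta_int] never takes the value
    -1. *)
Lemma dist_nearest u v (a s : Fstar B W u) : u \in W -> nearest a v ->
  (dist (Fvertex s) v)%:Z = (dist u v)%:Z + theta_int a s.
Proof.
move=> uW a_near; rewrite /theta_int.
have le_a : (dist (Fvertex a) v <= dist u v)%N by apply: (a_near star0).
have [s0|s0] := eqVneq s star0.
  by rewrite s0 eq_sym andbN addr0; congr (Posz (dist _ v)).
have us := Fvertex_adj s0.
have [sa|sa] := eqVneq s a.
  rewrite -sa s0 /=; have := @dist_closer _ _ _ v us.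
  by rewrite sa => /(_ le_a) ->; lia.
have lt_s : (dist u v < dist (Fvertex s) v)%N.
  rewrite ltnNge; apply/negP => le_s; have ds := dist_closer us le_s.
  have a0 : a != star0.
    by apply/eqP => a0; have := a_near s; rewrite a0 ds ltnn.
  case/eqP: sa; apply: val_inj.
  exact: closer_unique us (Fvertex_adj a0) le_s le_a.
by rewrite (@dist_closer _ (Fvertex s) u v) 1?adj_sym //=; lia.
Qed.

(** Two instances of the four-point condition bound the distance from both sides. The remaining sum
    of distances within the two stars is at most 2 and does no harm, as [dist u v] is even and
    nonzero. *)
Lemma dist_nearest2 u v (a s : Fstar B W u) (b t : Fstar B W v) :
  u \in W -> v \in W -> u != v -> nearest a v -> nearest b u ->
  (dist (Fvertex s) (Fvertex t))%:Z
  = (dist u v)%:Z + (theta_int a s + theta_int b t).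
Proof.
move=> uW vW uv av bu; have := dist_nearest s uW av; have := dist_nearest t vW bu.
have D0 : dist u v != 0%N by rewrite dist_eq0.
have := odd_dist hBW u v; rewrite uW vW /=.
have := Fvertex_dist s; have := Fvertex_dist t.
have := four_point (Fvertex s) v u (Fvertex t).
have := four_point (Fvertex s) (Fvertex t) u v.
rewrite !(dist_sym (Fvertex s) u) !(dist_sym (Fvertex t)) (dist_sym v u).
by case: (theta_intP a s) => ->; case: (theta_intP b t) => ->; lia.
Qed.

Lemma dist_Fvertex u (s t : Fstar B W u) :
  dist (Fvertex s) (Fvertex t)
  = if s == t then 0%N else if (s == star0) (+) (t == star0) then 1%N else 2%N.
Proof.
have [->|st] := eqVneq s t; first by rewrite distxx.
have [s0|s0] := eqVneq s star0.
  have [t0|t0] := eqVneq t star0; first by case/eqP: st; rewrite s0 t0.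
  rewrite s0; exact: adj_dist (Fvertex_adj t0).
have us := Fvertex_adj s0; have [->|t0] := eqVneq t star0.
  by rewrite dist_sym; apply: adj_dist us.
have ut := Fvertex_adj t0; have := dist_triangle (Fvertex s) u (Fvertex t).
rewrite (dist_sym _ u) (adj_dist us) (adj_dist ut) => le2 /=.
(* At distance at most 1, [s] and [t] would both be neighbours of [u] no farther from [t] than [u],
   hence equal. *)
apply/eqP; rewrite eqn_leq le2 ltnNge -(adj_dist ut) /=.
apply: contra st => le_st; rewrite -Fvertex_eq.
by apply/eqP/(closer_unique us ut le_st); rewrite distxx.
Qed.

Section Restrict.
Variables (R : realType) (f : T * T -> R) (u v : T).

Lemma restrict2_sum_of_basic (a : Fstar B W u) (b : Fstar B W v) (c p q r : R) :
  0 <= p -> 0 <= q -> 0 <= r ->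
  (forall (s : Fstar B W u) (t : Fstar B W v), f (Fvertex s, Fvertex t)
     = c + (p * theta R a s + q * theta R b t + r * mu R a b s t)) ->
  sum_of_basic (restrict2 B W (fun x : T * T => (f x)%:E) u v).
Proof.
move=> p0 q0 r0 fE.
apply: (@sum_of_basic2 R (Fstar2 B W u v) a b c p q r) => // x.
by congr EFin; apply: fE.
Qed.

End Restrict.
End Filters.

(** * The functions of the distance *)

Section DistanceFunctionsTheory.
Variables (R : realType) (T : tree) (B W : {pred T}) (h : int -> R).
Hypotheses (hBW : colour_classes B W).
Hypotheses (h_nondecr : nondecreasing_int h) (h_convex : convex_int h).
Implicit Types u v : T.

Lemma h_Tz_convex z : convex_tree (fun u : T => (h_Tz h z u)%:E).
Proof.
move=> u v; split=> [t|t]; first by case: ifP.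
(* If [t + 1] or [t - 1] leaves the path, the right-hand side is infinite. *)
have [|out] := boolP ((0 <= t + 1 <= (dist u v)%:Z) && (0 <= t - 1 <= (dist u v)%:Z));
  last first.
  move: out; rewrite negb_and => /orP[]/negPf ->; rewrite ?addey ?addye ?leey //.
  - by case: ifP.
  - by case: ifP.
move=> /andP[tp tm]; have -> : 0 <= t <= (dist u v)%:Z by lia.
rewrite tp tm -!EFinD lee_fin /h_Tz.
have [n tE] : exists n : nat, t = n.+1 by exists `|t - 1|%N; lia.
have -> : t + 1 = n.+2 by lia.
have -> : t - 1 = n by lia.
rewrite tE !absz_nat.
have [u0 v0] := @path_vertex_dist T u v n ltac:(lia).
have [u1 v1] := @path_vertex_dist T u v n.+1 ltac:(lia).
have [u2 v2] := @path_vertex_dist T u v n.+2 ltac:(lia).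
move: (path_vertex u v n) (path_vertex u v n.+1) (path_vertex u v n.+2) u0 v0 u1 v1 u2 v2.
move=> x y w u0 v0 u1 v1 u2 v2.
(* The middle one of three consecutive path vertices is a degenerate mid pair of the outer two. *)
have myxw : is_midpair x w y y.
  have := four_point x y u v; have := four_point y w u v.
  have := dist_triangle u x y; have := dist_triangle u y w.
  have := dist_triangle x y w; have := dist_triangle u x w.
  rewrite !(dist_sym _ u) => *; split; rewrite ?distxx; lia.
have := midpair_convex z myxw => ?.
by apply: convex_majorize => //; lia.
Qed.

Hypothesis hE : even_int h.

Lemma h_T_Lconvex : Lconvex B W (fun x : T * T => (h_T h x)%:E).
Proof.
split=> // -[u v] [u' v']; rewrite -!EFinD lee_fin /h_T /=.
have sum_le := bullet_circ_dist hBW u u' v v'.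
have := bullet_circ_dist_le1 hBW u u'; have := bullet_circ_dist_le1 hBW v v'.
have := @circ_in_W _ _ _ hBW u u'; have := @circ_in_W _ _ _ hBW v v'.
move: (bullet _ _ u u') (bullet _ _ v v') (circ _ _ u u') (circ _ _ v v') sum_le.
move=> b c a e sum_le eW aW le_ec le_ab.
have := dist_triangle a b e; have := dist_triangle b c e.
have := dist_triangle b a c; have := dist_triangle a e c.
rewrite (dist_sym c e) (dist_sym b a) => tr1 tr2 tr3 tr4.
rewrite addrC; apply: even_convex_majorize => //; try lia.
(* A gap of 2 forces both mid pairs to be edges, so [a] and [e] lie in [W] and their distance is
   even. *)
by move=> far; rewrite (odd_dist hBW) aW ?eW //; lia.
Qed.

Lemma h_Tzw_Lconvex z w : (z \in W) = (w \in W) ->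
  Lconvex B W (fun x : T * T => (h_Tzw h z w x)%:E).
Proof.
move=> zw; split=> // -[u v] [u' v']; rewrite -!EFinD lee_fin /h_Tzw /=.
have := bullet_circ_convex hBW u u' z; have := bullet_circ_convex hBW v v' w.
have := bullet_circ_dist_le1 hBW u u'; have := bullet_circ_dist_le1 hBW v v'.
have := @circ_in_W _ _ _ hBW u u'; have := @circ_in_W _ _ _ hBW v v'.
move: (bullet _ _ u u') (bullet _ _ v v') (circ _ _ u u') (circ _ _ v v').
move=> b c a e eW aW le_ec le_ab sum1 sum2.
have := dist_triangle a b z; have := dist_triangle b a z.
have := dist_triangle c e w; have := dist_triangle e c w.
rewrite (dist_sym c e) (dist_sym b a) => tr1 tr2 tr3 tr4.
rewrite addrC; apply: even_convex_majorize => //; try lia.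
(* Again [a] and [e] lie in [W]; as [z] and [w] share a colour, the two distances have the same
   parity. *)
by move=> far; rewrite oddD !(odd_dist hBW) aW ?eW ?zw; lia.
Qed.

(** Distances inside F(u) are 0, 1 or 2, and evenness at 1 makes [h] affine there. *)
Lemma h_T_delta u (s t : Fstar B W u) :
  h_T h (Fvertex s, Fvertex t) - h (dist u u)%:Z = Delta h 1 * delta R id s t.
Proof.
rewrite /h_T /delta /= distxx dist_Fvertex eq_sym; have := @hE 1 isT.
rewrite /Delta subrr [1 + 1]/=.
by case: ifP => _; [|case: ifP => _]; lra.
Qed.

Lemma h_T_Fvertex u v (s a : Fstar B W u) (t b : Fstar B W v) :
  nearest a v -> nearest b u ->
  let D : int := (dist u v)%:Z in
  [/\ u \in W -> v \in B ->
        h_T h (Fvertex s, Fvertex t) - h D = Delta h D * theta R a s,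
      u \in B -> v \in W ->
        h_T h (Fvertex s, Fvertex t) - h D = Delta h D * theta R b t,
      u \in W -> v \in W -> u != v ->
        h_T h (Fvertex s, Fvertex t) - h D
        = Delta h D * (theta R a s + theta R b t) + Delta2 h D * mu R a b s t
    & u \in B -> v \in B -> h_T h (Fvertex s, Fvertex t) - h D = 0].
Proof.
move=> av bu D; have BW := hBW.1; have Dodd := odd_dist hBW u v; rewrite /h_T /=.
split.
- move=> uW vB; rewrite (Fvertex_B hBW t vB) (dist_nearest s uW av) even_theta //.
  by move: vB; rewrite BW absz_nat Dodd uW => /negPf ->.
- move=> uB vW; rewrite (Fvertex_B hBW s uB) dist_sym (dist_nearest t vW bu).
  rewrite (dist_sym v) even_theta //.
  by move: uB; rewrite BW absz_nat Dodd vW => /negPf ->.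
- move=> uW vW uv; rewrite (dist_nearest2 hBW s t uW vW uv av bu) even_theta_mu //.
  by rewrite absz_nat Dodd uW vW.
- by move=> uB vB; rewrite (Fvertex_B hBW s uB) (Fvertex_B hBW t vB) subrr.
Qed.

Lemma h_Tzw_Fvertex z w u v (s a : Fstar B W u) (t b : Fstar B W v) :
  (z \in W) = (w \in W) -> nearest a z -> nearest b w ->
  let D : int := (dist u z + dist v w)%N%:Z in
  [/\ u \in W -> v \in B ->
        h_Tzw h z w (Fvertex s, Fvertex t) - h D = Delta h D * theta R a s,
      u \in B -> v \in W ->
        h_Tzw h z w (Fvertex s, Fvertex t) - h D = Delta h D * theta R b t,
      u \in W -> v \in W ->
        h_Tzw h z w (Fvertex s, Fvertex t) - h D
        = Delta h D * (theta R a s + theta R b t) + Delta2 h D * mu R a b s t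
    & u \in B -> v \in B -> h_Tzw h z w (Fvertex s, Fvertex t) - h D = 0].
Proof.
move=> zw az bw D; have BW := hBW.1.
have Dodd : odd `|D|%N = (u \in W) (+) (v \in W).
  rewrite absz_nat oddD !(odd_dist hBW) zw.
  by case: (u \in W); case: (v \in W); case: (w \in W).
rewrite /h_Tzw /=; split.
- move=> uW vB; rewrite (Fvertex_B hBW t vB) PoszD (dist_nearest s uW az) addrAC.
  by rewrite -PoszD even_theta // Dodd uW; move: vB; rewrite BW => /negPf ->.
- move=> uB vW; rewrite (Fvertex_B hBW s uB) PoszD (dist_nearest t vW bw) addrA.
  by rewrite -PoszD even_theta // Dodd vW; move: uB; rewrite BW => /negPf ->.
- move=> uW vW; rewrite PoszD (dist_nearest s uW az) (dist_nearest t vW bw) addrACA.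
  by rewrite -PoszD even_theta_mu // Dodd uW vW.
- by move=> uB vB; rewrite (Fvertex_B hBW s uB) (Fvertex_B hBW t vB) subrr.
Qed.

Lemma h_Tzw_sum_of_basic z w u v : (z \in W) = (w \in W) ->
  sum_of_basic (restrict2 B W (fun x : T * T => (h_Tzw h z w x)%:E) u v).
Proof.
move=> zw; have [a az] := nearest_exists B W u z; have [b bw] := nearest_exists B W v w.
set D := (dist u z + dist v w)%N%:Z.
(* A base vertex in [B] has a one-point filter, so its [theta] term gets coefficient 0. *)
pose p (c : bool) := if c then Delta h D else 0.
have p0 c : 0 <= p c by rewrite /p; case: c.
have BW := hBW.1.
apply: (@restrict2_sum_of_basic _ _ _ _ _ _ _ a b (h D) (p (u \in W)) (p (v \in W))
  (if (u \in W) && (v \in W) then Delta2 h D else 0)) => //; first by case: ifP.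
move=> s t; have := h_Tzw_Fvertex s t zw az bw; rewrite /p !BW -/D.
by case: (u \in W); case: (v \in W) => -[/= h1 h2 h3 h4];
  rewrite ?mul0r ?addr0 ?add0r ?addr0;
  [have := h3 isT isT | have := h1 isT isT | have := h2 isT isT | have := h4 isT isT];
  lra.
Qed.

Lemma h_T_sum_of_basic u v :
  sum_of_basic (restrict2 B W (fun x : T * T => (h_T h x)%:E) u v).
Proof.
(* The expansion by [theta] and [mu] requires [u != v] when both lie in [W]; the diagonal case is a
   multiple of [delta] instead. *)
have BW := hBW.1; have [uv|uv] := boolP ((u == v) && (u \in W)).
  case/andP: uv => /eqP <- uW.
  apply: (@sum_of_basic_delta R (Fstar2 B W u u) id (h (dist u u)) (Delta h 1)) => //.
    by exists id.
  by move=> x; congr EFin; rewrite -h_T_delta addrC subrK.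
have [a av] := nearest_exists B W u v; have [b bu] := nearest_exists B W v u.
set D := (dist u v)%:Z.
pose p (c : bool) := if c then Delta h D else 0.
have p0 c : 0 <= p c by rewrite /p; case: c.
apply: (@restrict2_sum_of_basic _ _ _ _ _ _ _ a b (h D) (p (u \in W)) (p (v \in W))
  (if (u \in W) && (v \in W) then Delta2 h D else 0)) => //; first by case: ifP.
move=> s t; have := h_T_Fvertex s t av bu; rewrite /p !BW -/D.
move: uv; rewrite andbC; case: (u \in W); case: (v \in W) => /= uv -[h1 h2 h3 h4];
  rewrite ?mul0r ?addr0 ?add0r ?addr0;
  [have := h3 isT isT uv | have := h1 isT isT | have := h2 isT isT | have := h4 isT isT];
  lra.
Qed.

End DistanceFunctionsTheory.

Theorem theorem2p15 (R : realType) (T : tree) (B W : {pred T})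
    (hBW : colour_classes B W) (h : int -> R)
    (h_nondecr : nondecreasing_int h) (h_convex : convex_int h) (z w : T) :
  [/\ (* (1) *)
      convex_tree (fun u : T => (h_Tz h z u)%:E),
      (* (2) *)
      even_int h ->
      Lconvex B W (fun x : T * T => (h_T h x)%:E) /\
      (forall u v : T,
        sum_of_basic
          (restrict2 B W (fun x : T * T => (h_T h x)%:E) u v)) /\
      [/\ forall (u : T) (s t : Fstar B W u), u \in W ->
            h_T h (Fvertex s, Fvertex t) - h (dist u u)%:Z
            = Delta h 1 * delta R id s t
        & forall (u v : T) (s : Fstar B W u) (t : Fstar B W v)
            (a : Fstar B W u) (b : Fstar B W v),
          nearest a v -> nearest b u ->
          let D : int := (dist u v)%:Z in
          [/\ u \in W -> v \in B ->
                h_T h (Fvertex s, Fvertex t) - h D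
                = Delta h D * theta R a s,
              u \in B -> v \in W ->
                h_T h (Fvertex s, Fvertex t) - h D
                = Delta h D * theta R b t,
              u \in W -> v \in W -> u != v ->
                h_T h (Fvertex s, Fvertex t) - h D
                = Delta h D * (theta R a s + theta R b t)
                  + Delta2 h D * mu R a b s t
            & u \in B -> v \in B ->
                h_T h (Fvertex s, Fvertex t) - h D = 0]]
    & (* (3) *)
      even_int h -> (z \in W) = (w \in W) ->
      Lconvex B W (fun x : T * T => (h_Tzw h z w x)%:E) /\
      (forall u v : T,
        sum_of_basic
          (restrict2 B W (fun x : T * T => (h_Tzw h z w x)%:E) u v)) /\
      (forall (u v : T) (s : Fstar B W u) (t : Fstar B W v)
          (a : Fstar B W u) (b : Fstar B W v),
        nearest a z -> nearest b w ->
        let D : int := (dist u z + dist v w)%N%:Z in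
        [/\ u \in W -> v \in B ->
              h_Tzw h z w (Fvertex s, Fvertex t) - h D
              = Delta h D * theta R a s,
            u \in B -> v \in W ->
              h_Tzw h z w (Fvertex s, Fvertex t) - h D
              = Delta h D * theta R b t,
            u \in W -> v \in W ->
              h_Tzw h z w (Fvertex s, Fvertex t) - h D
              = Delta h D * (theta R a s + theta R b t)
                + Delta2 h D * mu R a b s t
          & u \in B -> v \in B ->
              h_Tzw h z w (Fvertex s, Fvertex t) - h D = 0])].
Proof.
split; first exact: h_Tz_convex.
  move=> hE; split; first exact: h_T_Lconvex.
  split; first exact: h_T_sum_of_basic.
  split=> [u s t _|u v s t a b]; first exact: h_T_delta.
  exact: h_T_Fvertex.
move=> hE zw; split; first exact: h_Tzw_Lconvex.
split; first by move=> u v; exact: h_Tzw_sum_of_basic.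
by move=> u v s t a b; exact: h_Tzw_Fvertex.
Qed.
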